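(* Fix $\delta\in(0,1)$, $K\ge 1$ and $T\subset\mathbb{R}_0^d$. Let $X_1,\ldots,X_d$ be i.i.d. non-negative random variables such that for some $C>1$ we have $$\forall t\ge K\,\mathbf{E}X_i:\quad \mathbf{P}(X_i\ge t)\ \ge\ C\,\mathbf{P}(X_i\ge 2t).$$ Then there exist a constant $L=L(\delta,C,K)$ and a family $\mathcal{G}\subset\{(x_\ast,W): x_\ast\in\mathbb{R}_0^d,\ W\subset[d]\}$ such that (i) for all $(x_\ast,W)\in\mathcal{G}$ and all $i\in W$: $x_\ast(i)\ge K\,\mathbf{E}X_i$; (ii) $$\Big\{x\in\mathbb{R}_0^d:\ \sup_{t\in T}\sum_{i=1}^d t_i x(i)\ \ge\ L\,\mathbf{E}\sup_{t\in T}\sum_{i=1}^d t_i X_i\Big\}\ \subset\ \bigcup_{(x_\ast,W)\in\mathcal{G}}\{x\in\mathbb{R}_0^d:\ \forall i\in W\ \ x(i)\ge x_\ast(i)\};$$ (iii) $$\sum_{(x_\ast,W)\in\mathcal{G}}\mathbf{P}\big(\forall i\in W\ \ X_i\ge x_\ast(i)\big)\ \le\ \delta.$$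
   Context: $\mathbb{R}_0=[0,\infty)$, $[d]=\{1,\ldots,d\}$, and $x(i)$ denotes the $i$-th coordinate of a vector $x\in\mathbb{R}^d$ (coordinates of $t\in T$ are written $t_i$). The notation $L=L(\delta,C,K)$ means that $L$ depends only on $\delta,C,K$.
   Formalization: T is additionally assumed bounded and to contain a nonzero vector; for T={0} or unbounded T the claim fails, since (ii) would force covering a point with all coordinates below K·E X_i, hence W empty with probability 1>δ. *)

(* Defs.v *)
From HB Require Import structures.
From mathcomp Require Import all_boot all_order all_algebra.
From mathcomp Require Import all_classical all_reals all_analysis.

Set Implicit Arguments.
Unset Strict Implicit.
Unset Printing Implicit Defensive.

Import Order.TTheory GRing.Theory Num.Theory.
Import numFieldNormedType.Exports.

Local Open Scope classical_set_scope.
Local Open Scope ring_scope.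
Local Open Scope ereal_scope.

Definition orthant (R : realType) (d : nat) : set 'rV[R]_d :=
  [set x | forall i : 'I_d, (0 <= x ord0 i)%R].

(* Extended-real valued: -oo for empty T, +oo when the sums are unbounded. *)
Definition lin_sup (R : realType) (d : nat) (T : set 'rV[R]_d)
    (x : 'rV[R]_d) : \bar R :=
  ereal_sup [set (\sum_(i < d) t ord0 i * x ord0 i)%R%:E | t in T].

Definition rv_vector (dd : measure_display) (Omega : measurableType dd)
    (R : realType) (P : probability Omega R) (d : nat)
    (X : 'I_d -> {RV P >-> R}) (w : Omega) : 'rV[R]_d :=
  \row_(i < d) X i w.

(* Expectation of an extended-real valued supremum; the library's 'E_P is
   restricted to real-valued functions. *)
Definition expected_lin_sup (dd : measure_display) (Omega : measurableType dd)
    (R : realType) (P : probability Omega R) (d : nat) (T : set 'rV[R]_d)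
    (X : 'I_d -> {RV P >-> R}) : \bar R :=
  \int[P]_w lin_sup T (rv_vector X w).

Definition mutually_independent (dd : measure_display)
    (Omega : measurableType dd) (R : realType) (P : probability Omega R)
    (d : nat) (X : 'I_d -> {RV P >-> R}) : Prop :=
  forall (J : {set 'I_d}) (B : 'I_d -> set R),
    (forall i, i \in J -> measurable (B i)) ->
    P (\bigcap_(i in [set i : 'I_d | i \in J]) (X i @^-1` B i)) =
    \prod_(i in J) P (X i @^-1` B i).

Definition identically_distributed (dd : measure_display)
    (Omega : measurableType dd) (R : realType) (P : probability Omega R)
    (d : nat) (X : 'I_d -> {RV P >-> R}) : Prop :=
  forall (i j : 'I_d) (B : set R), measurable B ->
    distribution P (X i) B = distribution P (X j) B.

Definition iid (dd : measure_display)
    (Omega : measurableType dd) (R : realType) (P : probability Omega R)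
    (d : nat) (X : 'I_d -> {RV P >-> R}) : Prop :=
  mutually_independent X /\ identically_distributed X.

(* {x | forall i in W, x(i) >= x_*(i)} for a pair g = (x_*, W) *)
Definition dominates (R : realType) (d : nat) (g : 'rV[R]_d * {set 'I_d})
    : set 'rV[R]_d :=
  [set x | forall i : 'I_d, i \in g.2 -> (g.1 ord0 i <= x ord0 i)%R].

(* Main.v *)
(* Let [M] be the expected supremum and [a := K E X_i].  Coordinates are rounded
   down to the grid [0, a, 2a, 4a, ...]; rounding costs a large [x] only a
   constant factor and the term [a * sum t <= K M].  The tail condition says
   that a threshold [2 ^ j] times higher than a grid value is exceeded with
   probability at most [eta] times that of the grid value itself, with [eta] as
   small as we like.

   Fix a light grid point [x], i.e. [t.x < 2 M] for all [t] in [T] (the rounded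
   sample is light with probability at least 1/2, by Markov), and let [y] be a
   grid point with [t.y >= 4 M] for some [t].  Take a smallest set [U] of
   coordinates of [y] such that overwriting [x] by [y] on [U] gives a [z] with
       2 (t.z) - (sum of the 2 #|U| largest t_i z_i) >= 4 M   for some [t].
   By minimality [U] lies inside the [2 #|U|] largest coordinates of [z] for
   [t].  Since [t] may be chosen as a function of [z] and [#|U|], the point [z]
   leaves at most [4 ^ u] possibilities for a [U] of size [u].  Exchanging [x]
   and [y] on [U] then shows that the average over [x] of the total cost of
   these fragments of all [y] is at most [sum_(u > 0) (4 eta) ^ u], so some
   light [x] gives a cheap cover. *)

Require Import Defs.
From HB Require Import structures.
From mathcomp Require Import all_boot all_order all_algebra.
From mathcomp Require Import all_classical all_reals all_analysis.
From mathcomp Require Import measurable_realfun lra.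

Set Implicit Arguments.
Unset Strict Implicit.
Unset Printing Implicit Defensive.

Import Order.TTheory GRing.Theory Num.Theory.
Import numFieldNormedType.Exports.

Local Open Scope classical_set_scope.
Local Open Scope ring_scope.
Local Open Scope ereal_scope.

Section esum_extra.
Context {R : realType}.
Implicit Types (J : choiceType) (c : \bar R).

Lemma subset_esum J (A B : set J) (a : J -> \bar R) :
  A `<=` B -> \esum_(j in A) a j <= \esum_(j in B) a j.
Proof.
move=> AB; apply/ereal_sup_le/image_subset => X [finX XA].
by split=> //; exact: subset_trans AB.
Qed.

Lemma esumZl J (A : set J) (a : J -> \bar R) c :
  0 <= c -> (forall j, 0 <= a j) ->
  \esum_(j in A) (c * a j) = c * \esum_(j in A) a j.
Proof.
case: c => [c| |]//; rewrite ?lee_fin => c0 a0.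
  rewrite /esum -ereal_supZl//; last first.
    by apply/set0P; exists 0, set0; [exact: fsets_set0|rewrite fsbig_set0].
  rewrite image_comp; congr ereal_sup; apply: eq_imagel => X _ /=.
  by rewrite ge0_mule_fsumr.
have [a_eq0|/existsNP[j /not_implyP[Aj /eqP aj_neq0]]] :=
    pselect (forall j, A j -> a j = 0).
  by rewrite !esum1 ?mule0// => j /a_eq0 ->; rewrite mule0.
have aj_gt0 : 0 < a j by rewrite lt_neqAle eq_sym aj_neq0 a0.
have le_term (b : J -> \bar R) :
    (forall i, 0 <= b i) -> b j <= \esum_(i in A) b i.
  by move=> b0; rewrite -(esum_set1 (b0 j)); apply: subset_esum => _ ->.
rewrite gt0_mulye ?(lt_le_trans aj_gt0 (le_term _ a0))//.
apply/eqP; rewrite -leye_eq -{1}(gt0_mulye aj_gt0).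
by apply: (le_term (fun i => +oo * a i)) => i; rewrite mule_ge0.
Qed.

Lemma esum_fibers J (U : finType) (h : J -> U) (A : set J) (a : J -> \bar R) :
  (forall j, A j -> 0 <= a j) ->
  \esum_(j in A) a j = \sum_(u : U) \esum_(j in A `&` [set j | h j = u]) a j.
Proof.
move=> a0; under [RHS]eq_bigr do rewrite esum_mkcondr.
rewrite -esum_sum => [|j u Aj _]; last by case: ifP => // _; exact: a0.
apply: eq_esum => j _; rewrite -big_mkcond (big_pred1 (h j))// => u.
by apply/idP/eqP => [|->]; rewrite inE.
Qed.

Lemma exists_le_of_weighted_esum_lt J (A : set J) (p s : J -> \bar R)
    (m b c : R) :
  (0 <= c)%R -> (forall j, 0 <= p j) -> (forall j, 0 <= s j) ->
  m%:E <= \esum_(j in A) p j ->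
  \esum_(j in [set: J]) (p j * s j) <= b%:E -> (b < c * m)%R ->
  exists2 j, A j & s j <= c%:E.
Proof.
move=> c0 p0 s0 mp psb; rewrite ltNge; apply: contraNP => /forall2NP large.
rewrite -lee_fin; apply: le_trans psb.
apply: le_trans (subset_esum _ (@subsetT _ A)).
rewrite EFinM (le_trans (lee_wpmul2l _ mp))// -esumZl//.
apply: le_esum => j Aj; rewrite muleC lee_wpmul2l//.
by have [//|/negP] := large j; rewrite -ltNge => /ltW.
Qed.

End esum_extra.

Lemma lee_prod (R : realDomainType) (I : Type) (s : seq I) (Q : pred I)
    (f g : I -> \bar R) :
  (forall i, Q i -> 0 <= f i <= g i) ->
  \prod_(i <- s | Q i) f i <= \prod_(i <- s | Q i) g i.
Proof.
move=> fg; pose le_ge0 (u v : \bar R) := 0 <= u <= v.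
suff /andP[] : le_ge0 (\prod_(i <- s | Q i) f i) (\prod_(i <- s | Q i) g i).
  by [].
apply: (big_ind2 le_ge0) => [|u1 v1 u2 v2 /andP[? ?] /andP[? ?]|//].
  by rewrite /le_ge0 lee_fin ler01/=.
by apply/andP; split; [exact: mule_ge0|exact: lee_pmul].
Qed.

Section heaviest_coordinates.
Context {R : realDomainType} {I : finType}.
Implicit Types (c : I -> R) (A B V : {set I}) (m n : nat).

Definition heaviest m c : {set I} :=
  [set i in take m (sort (relpre c >=%O) (enum I))]%SET.

Lemma card_heaviest m c : #|heaviest m c| = minn m #|I|.
Proof.
rewrite cardsE (card_uniqP _) ?take_uniq ?sort_uniq ?enum_uniq//.
by rewrite size_take_min size_sort -cardE.
Qed.

Lemma heaviest_ge m c i b :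
  i \notin heaviest m c -> b \in heaviest m c -> (c i <= c b)%R.
Proof.
have : sorted (relpre c >=%O) (sort (relpre c >=%O) (enum I)).
  by apply: sort_sorted => b1 b2 /=; rewrite real_leVge ?num_real.
rewrite !inE sorted_pairwise; last by move=> ? ? ? /= h /le_trans; exact.
have : i \in sort (relpre c >=%O) (enum I) by rewrite mem_sort mem_enum.
rewrite -{1 2}(cat_take_drop m (sort _ _)) mem_cat pairwise_cat.
by move=> /orP[->//|iD] /andP[/allrelP bD _] _ bT; exact: bD.
Qed.

Lemma heaviest_threshold m c : (forall i, (0 <= c i)%R) ->
  exists tau, [/\ (0 <= tau)%R, {in heaviest m c, forall b, (tau <= c b)%R}
    & forall i, i \notin heaviest m c -> (c i <= tau)%R].
Proof.
move=> c_ge0.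
exists (\big[Order.max/0]_(i | i \notin heaviest m c) c i)%R; split.
- exact: bigmax_ge_id.
- by move=> b bA; apply: bigmax_le => // i iA; exact: heaviest_ge bA.
- by move=> i iA; exact: le_bigmax_cond.
Qed.

Lemma leq_card_heaviest m c B V k :
  V \subset ~: heaviest m c -> (#|B| + #|V| * k <= m)%N ->
  (#|B| + #|V| * k <= #|heaviest m c|)%N.
Proof.
move=> /fintype.subsetP VA Bm; rewrite card_heaviest leq_min Bm/=.
have [->|] := posnP #|V|; first by rewrite mul0n addn0 max_card.
rewrite card_gt0 => /set0Pn[i /VA]; rewrite inE => iA.
apply: (leq_trans Bm); rewrite leqNgt; apply: contra iA => Im.
suff -> : heaviest m c = [set: I]%SET by rewrite inE.
apply/eqP; rewrite eqEcard finset.subsetT cardsT card_heaviest.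
by rewrite leq_min leqnn ltnW.
Qed.

Lemma sum_le_heaviest m c B V k : (forall i, (0 <= c i)%R) ->
  V \subset ~: heaviest m c -> (#|B| + #|V| * k <= m)%N ->
  (\sum_(i in B) c i + (\sum_(i in V) c i) *+ k
    <= \sum_(i in heaviest m c) c i)%R.
Proof.
move=> c_ge0; set A := heaviest m c => VA Bm.
have [tau [tau_ge0 A_ge_tau AC_le_tau]] := heaviest_threshold m c_ge0.
have cardA := leq_card_heaviest VA Bm.
have sum_le_tau (E : {set I}) :
    E \subset ~: A -> (\sum_(i in E) c i <= tau *+ #|E|)%R.
  move=> /fintype.subsetP EA; rewrite -sumr_const; apply: ler_sum => i /EA.
  by rewrite inE => /AC_le_tau.
have rest_le : (\sum_(i in B :\: A) c i + (\sum_(i in V) c i) *+ k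
    <= tau *+ (#|B :\: A| + #|V| * k))%R.
  rewrite mulrnDr mulrnA lerD ?lerMn2r ?sum_le_tau ?orbT//.
  by rewrite finset.setDE finset.subsetIr.
rewrite (big_setID A) [leRHS](big_setID B)/= finset.setIC -addrA lerD2l.
apply: (le_trans rest_le); apply: le_trans (_ : tau *+ #|A :\: B| <= _)%R.
  apply: ler_wpMn2l => //; rewrite -(leq_add2l #|B :&: A|) addnA cardsID.
  by rewrite finset.setIC cardsID.
by rewrite -sumr_const; apply: ler_sum => i; rewrite inE => /andP[_ /A_ge_tau].
Qed.

Definition heavy (l : R) m c := forall A, (#|A| <= m)%N ->
  (l + \sum_(i in A) c i <= (\sum_i c i) *+ 2)%R.

Lemma heavy0 l c : heavy l 0 c -> (l <= (\sum_i c i) *+ 2)%R.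
Proof. by move=> /(_ finset.set0); rewrite cards0 big_set0 addr0; exact. Qed.

Lemma sum_ge_heavy l m c : (forall i, (0 <= c i)%R) -> (l <= \sum_i c i)%R ->
  heavy l m c.
Proof.
move=> c_ge0 lc A _; rewrite mulr2n lerD// [leRHS](bigID (mem A))/= lerDl.
exact: sumr_ge0.
Qed.

(* Erasing [V], which lies outside the [m] heaviest coordinates, costs twice the
   sum over [V]; the freed [2 * #|V|] heaviest coordinates pay for it. *)
Lemma heavy_erase l m n c c' V :
  (forall i, (0 <= c i)%R) -> (forall i, (0 <= c' i)%R) ->
  (forall i, i \notin V -> c' i = c i) ->
  V \subset ~: heaviest m c -> (n + #|V| * 2 <= m)%N ->
  heavy l m c -> heavy l n c'.
Proof.
move=> c_ge0 c'_ge0 cc' VA nm heavyc B Bn.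
have compensate : (\sum_(i in B :\: V) c i + (\sum_(i in V) c i) *+ 2
    <= \sum_(i in heaviest m c) c i)%R.
  apply: sum_le_heaviest => //; apply: leq_trans nm.
  by rewrite leq_add2r (leq_trans _ Bn)// subset_leq_card// finset.subsetDl.
have erased_loss : (\sum_(i in B) c' i + (\sum_i c i) *+ 2 <=
    (\sum_i c' i) *+ 2 +
      (\sum_(i in B :\: V) c i + (\sum_(i in V) c i) *+ 2))%R.
  rewrite (big_mkcond (fun i => i \in B)) (big_mkcond (fun i => i \in B :\: V)).
  rewrite (big_mkcond (fun i => i \in V)) -!sumrMnl -!big_split/=.
  apply: ler_sum => i _; rewrite inE; have := c_ge0 i; have := c'_ge0 i.
  by have [|/cc'->] := boolP (i \in V); case: (i \in B) => /= *; lra.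
have := heavyc (heaviest m c); rewrite card_heaviest geq_minl => /(_ isT).
move: compensate erased_loss; lra.
Qed.

End heaviest_coordinates.

Section splicing.
Context {I : finType} {K : nmodType}.
Implicit Types (x y g : {ffun I -> K}) (U : {set I}).

Definition fsupp g : {set I} := [set i | g i != 0%R]%SET.

Definition splice U y x : {ffun I -> K} :=
  [ffun i => if i \in U then y i else x i].

Definition fragments (core : nat -> {ffun I -> K} -> {set I}) x :
    set {ffun I -> K} :=
  [set g | fsupp g != finset.set0 /\
    fsupp g \subset core (#|fsupp g| * 2)%N (splice (fsupp g) g x)].

Lemma fsupp_out U g i : fsupp g \subset U -> i \notin U -> g i = 0%R.
Proof.
move=> /fintype.subsetP gU; apply: contraNeq => gi.
by apply: gU; rewrite inE.
Qed.

Lemma fsupp_splice0 U y : U \subset fsupp y -> fsupp (splice U y 0%R) = U.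
Proof.
move=> /fintype.subsetP Uy; apply/setP => i; rewrite inE !ffunE.
by case: ifPn => [/Uy|]; rewrite ?inE ?eqxx.
Qed.

Lemma fsupp_splice0_subset U y : fsupp (splice U y 0%R) \subset U.
Proof.
apply/fintype.subsetP => i; rewrite inE !ffunE.
by case: ifPn => //; rewrite eqxx.
Qed.

Lemma splice_setT y x : splice [set: I]%SET y x = y.
Proof. by apply/ffunP => i; rewrite ffunE inE. Qed.

Lemma splice_splice U y x z : splice U (splice U y z) x = splice U y x.
Proof. by apply/ffunP => i; rewrite !ffunE; case: (i \in U). Qed.

Lemma spliceK U g x : splice U (splice U x 0%R) (splice U g x) = x.
Proof. by apply/ffunP => i; rewrite !ffunE; case: (i \in U). Qed.

Lemma splice0K U g x :
  fsupp g \subset U -> splice U (splice U g x) 0%R = g.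
Proof.
move=> gU; apply/ffunP => i; rewrite !ffunE.
by have [//|/(fsupp_out gU)] := boolP (i \in U).
Qed.

End splicing.

Section heavy_fragments.
Context {R : realDomainType} {I : finType} {K : nmodType} {J : pointedType}.
Variables (T : set J) (load : J -> I -> K -> R) (l : R).
Hypothesis load_ge0 : forall t, T t -> forall i k, (0 <= load t i k)%R.
Hypothesis load0 : forall t, T t -> forall i, load t i 0 = 0%R.
Implicit Types (x y z g : {ffun I -> K}) (t : J) (U : {set I}) (m : nat).

Definition loads t z : I -> R := fun i => load t i (z i).

Definition heavy_at m z : set J := [set t | T t /\ heavy l m (loads t z)].

(* If no [t] is heavy at [z], the arbitrary [t] returned by [get] is harmless:
   only the size of [heavy_core] matters then. *)
Definition heavy_core m z : {set I} :=
  heaviest m (loads (get (heavy_at m z)) z).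

Lemma card_heavy_core m z : (#|heavy_core m z| <= m)%N.
Proof. by rewrite card_heaviest geq_minl. Qed.

Let loads_ge0 t z : T t -> forall i, (0 <= loads t z i)%R.
Proof. by move=> Tt i; exact: load_ge0. Qed.

Definition heavy_splice x y U : Prop :=
  exists t, heavy_at (#|U| * 2) (splice U y x) t.

Lemma heavy_splice_fsupp x y :
  (exists2 t, T t & (l <= \sum_i loads t y i)%R) -> heavy_splice x y (fsupp y).
Proof.
move=> [t Tt ly]; exists t; split => //.
apply: sum_ge_heavy; first exact: loads_ge0.
apply: (le_trans ly); apply: ler_sum => i _; rewrite /loads ffunE inE.
by case: eqVneq => //= ->; rewrite load0// load_ge0.
Qed.

Lemma heavy_splice_core x y U : heavy_splice x y U ->
  heavy_splice x y (U :&: heavy_core (#|U| * 2) (splice U y x)).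
Proof.
set z := splice U y x => -[t0 /getI]; set t := get _ => -[Tt heavyt].
exists t; split => //.
apply: (heavy_erase (V := U :\: heavy_core (#|U| * 2) z)) heavyt;
  try exact: loads_ge0.
- move=> i; rewrite /loads !ffunE !inE.
  by case: (i \in U); rewrite //= andbT negbK => ->.
- by rewrite finset.setDE finset.subsetIr.
- by rewrite -mulnDl cardsID.
Qed.

Lemma fragment_exists x y :
  (forall t, T t -> ((\sum_i loads t x i) *+ 2 < l)%R) ->
  (exists2 t, T t & (l <= \sum_i loads t y i)%R) ->
  exists2 g, fragments heavy_core x g & forall i, i \in fsupp g -> g i = y i.
Proof.
move=> light /heavy_splice_fsupp-/(_ x) y_heavy.
pose Q := [pred U : {set I} | (U \subset fsupp y) && `[< heavy_splice x y U >]].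
have Qy : Q (fsupp y) by rewrite /= fintype.subxx; exact/asboolP.
case: (@arg_minnP _ _ Q (fun U : {set I} => #|U|) Qy) => U.
move=> /andP[Uy /asboolP Uheavy] Umin.
have UE : fsupp (splice U y 0%R) = U by exact: fsupp_splice0.
exists (splice U y 0%R); last by move=> i; rewrite UE ffunE => ->.
rewrite /fragments/= UE splice_splice; split.
  apply/eqP => U0; move: Uheavy => [t [Tt]]; rewrite U0 cards0 => /heavy0.
  rewrite leNgt (eq_bigr (loads t x)); first by rewrite light.
  by move=> i _; rewrite /loads ffunE inE.
have /Umin : Q (U :&: heavy_core (#|U| * 2) (splice U y x)).
  rewrite /= (fintype.subset_trans _ Uy) ?finset.subsetIl//=.
  exact/asboolP/heavy_splice_core.
move=> cardU; apply/finset.setIidPl/eqP.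
by rewrite eqEcard finset.subsetIl.
Qed.

End heavy_fragments.

Lemma sum_expr_subsets_le (R : realType) (I : finType) (eta : R)
    (A : nat -> {set I}) :
  (0 <= eta)%R -> (eta <= 8^-1)%R -> (forall m, (#|A m| <= m)%N) ->
  (\sum_(U : {set I} | (U != finset.set0) && (U \subset A (#|U| * 2)%N))
     eta ^+ #|U| <= 8 * eta)%R.
Proof.
move=> eta_ge0 eta8 cardA; pose N := #|I|.
apply: (@le_trans _ _ (\sum_(u < N)
    \sum_(U : {set I} | U \subset A (u.+1 * 2)%N) eta ^+ u.+1)%R).
  rewrite (exchange_big_dep predT)//= [leLHS]big_mkcond/=.
  apply: ler_sum => U _.
  have sum_ge0 (Q : pred 'I_N) : (0 <= \sum_(u < N | Q u) eta ^+ u.+1)%R.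
    by apply: sumr_ge0 => u _; rewrite exprn_ge0.
  case: ifPn => // /andP[]; rewrite -card_gt0 => U0 UA.
  have UN : (#|U|.-1 < N)%N by rewrite prednK ?max_card.
  by rewrite (bigD1 (Ordinal UN))/= prednK// lerDl.
apply: (@le_trans _ _ (series (geometric (4 * eta) (4 * eta)) N)%R).
  rewrite /series/= big_mkord; apply: ler_sum => u _; rewrite sumr_const.
  rewrite -exprS exprMn -[leLHS]mulr_natl ler_wpM2r ?exprn_ge0//.
  rewrite (eq_card (B := powerset (A (u.+1 * 2)%N))); last first.
    by move=> U; rewrite inE.
  rewrite card_powerset -(natrX _ 4) -[4%N]/(2 ^ 2)%N -expnM mulnC.
  by rewrite ler_nat leq_pexp2l.
have [->|eta_neq0] := eqVneq eta 0%R.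
  by rewrite mulr0 /series/= big1// => u _; rewrite mul0r.
have eta_gt0 : (0 < eta)%R by rewrite lt_neqAle eq_sym eta_neq0.
apply: le_trans (geometric_le_lim N _ _ _) _; rewrite ?ger0_norm; try lra.
by rewrite ler_pdivrMr; [nra|lra].
Qed.

Section fragment_counting.
Context {R : realType} {I : finType} {K : nmodType}.
Variables (r : I -> K -> \bar R) (core : nat -> {ffun I -> K} -> {set I}).
Implicit Types (x z g h : {ffun I -> K}) (U : {set I}) (eta : R).

Definition weight U h : \bar R := \prod_(i in U) r i (h i).

Definition fragment_cost eta x : \bar R := \esum_(g in fragments core x)
  ((eta ^+ #|fsupp g|)%:E * weight (fsupp g) g).

Hypothesis r_ge0 : forall i k, 0 <= r i k.
Hypothesis card_core : forall m z, (#|core m z| <= m)%N.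
Hypothesis weight_le1 : forall U,
  \esum_(h in [set h | fsupp h \subset U]) weight U h <= 1.

Lemma weight_ge0 U h : 0 <= weight U h.
Proof. exact: prode_ge0. Qed.

Lemma fragment_cost_ge0 eta x : (0 <= eta)%R -> 0 <= fragment_cost eta x.
Proof.
move=> eta0; apply: esum_ge0 => g _.
by rewrite mule_ge0 ?weight_ge0// lee_fin exprn_ge0.
Qed.

Lemma weight_splice_swap U x g :
  weight [set: I]%SET x * weight U g =
  weight [set: I]%SET (splice U g x) * weight U (splice U x 0%R).
Proof.
have mkcond V h : weight V h = \prod_i (if i \in V then r i (h i) else 1).
  by rewrite /weight big_mkcond.
rewrite !mkcond -!big_split/=; apply: eq_bigr => i _.
by rewrite !inE !ffunE; case: (i \in U); rewrite //= muleC.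
Qed.

(* The exchange [(x, g) |-> (splice U g x, x on U)] is an involution. *)
Lemma esum_splice_le U (Z : set {ffun I -> K}) :
  \esum_(x in [set: {ffun I -> K}])
    \esum_(g in [set g | fsupp g \subset U /\ Z (splice U g x)])
      (weight [set: I]%SET x * weight U g)
  <= \esum_(z in Z) weight [set: I]%SET z.
Proof.
have weight_mul_ge0 x g : 0 <= weight [set: I]%SET x * weight U g.
  by rewrite mule_ge0 ?weight_ge0.
pose swap (k : {ffun I -> K} * {ffun I -> K}) :=
  (splice U k.2 k.1, splice U k.1 0%R).
have swapK : {in [set k | fsupp k.2 \subset U], cancel swap swap}.
  by move=> [x g]; rewrite inE /swap/= => gU; rewrite spliceK splice0K.
rewrite esum_esum//.
under eq_esum => k _ do rewrite weight_splice_swap.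
rewrite -(esum_image _ swap (fun k => weight [set: I]%SET k.1 * weight U k.2));
  last first.
  apply: (sub_in2 _ (can_in_inj swapK)) => -[x g].
  by rewrite !inE/= => -[_ []].
apply: (@le_trans _ _ (\esum_(z in Z) \esum_(h in [set h | fsupp h \subset U])
    (weight [set: I]%SET z * weight U h))).
  rewrite esum_esum//; apply: subset_esum => _ [[x g] [_ [gU Zg]] <-].
  by split=> //=; exact: fsupp_splice0_subset.
apply: le_esum => z _; rewrite (esumZl _ (weight_ge0 _ _) (weight_ge0 _)).
by rewrite -[leRHS]mule1 lee_wpmul2l ?weight_ge0.
Qed.

Lemma weighted_fragment_cost_le eta : (0 <= eta)%R ->
  \esum_(x in [set: {ffun I -> K}])
    (weight [set: I]%SET x * fragment_cost eta x)
  <= \sum_(U | U != finset.set0) (eta ^+ #|U|)%:E *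
       \esum_(z in [set z | U \subset core (#|U| * 2)%N z])
         weight [set: I]%SET z.
Proof.
move=> eta0.
have weight_mul_ge0 x U g : 0 <= weight [set: I]%SET x * weight U g.
  by rewrite mule_ge0 ?weight_ge0.
have eta_ge0 n : 0 <= (eta ^+ n)%:E by rewrite lee_fin exprn_ge0.
pose pieces U x := \esum_(g in [set g | fsupp g \subset U /\
    U \subset core (#|U| * 2)%N (splice U g x)])
      (weight [set: I]%SET x * weight U g).
have pieces_ge0 U x : 0 <= pieces U x by apply: esum_ge0.
apply: (@le_trans _ _ (\esum_(x in [set: {ffun I -> K}])
    \sum_(U | U != finset.set0) (eta ^+ #|U|)%:E * pieces U x)).
  apply: le_esum => x _; rewrite -esumZl ?weight_ge0//; last first.
    by move=> g; rewrite mule_ge0 ?weight_ge0.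
  rewrite (esum_fibers fsupp); last first.
    by move=> g _; rewrite !mule_ge0 ?weight_ge0.
  rewrite [leRHS]big_mkcond; apply: lee_sum => U _.
  case: ifPn => [U0|/negbNE/eqP->]; last first.
    by rewrite esum1// => g [[/[swap] _ g0] /= gU]; rewrite gU eqxx in g0.
  rewrite -esumZl//; apply: le_trans (subset_esum _ _).
    by apply: le_esum => g [_ /= gU]; rewrite gU muleCA.
  by move=> g [[_ gcore] /= gU]; split; rewrite -?gU.
rewrite esum_sum => [|x U _ _]; last exact: mule_ge0.
apply: lee_sum => U _; rewrite esumZl//.
by rewrite lee_wpmul2l// esum_splice_le.
Qed.

Lemma expected_fragment_cost_le eta : (0 <= eta)%R -> (eta <= 8^-1)%R ->
  \esum_(x in [set: {ffun I -> K}])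
    (weight [set: I]%SET x * fragment_cost eta x) <= (8 * eta)%:E.
Proof.
move=> eta0 eta8.
have eta_ge0 n : 0 <= (eta ^+ n)%:E by rewrite lee_fin exprn_ge0.
apply: (le_trans (weighted_fragment_cost_le eta0)).
under eq_bigr => U _ do
  rewrite -(esumZl _ (eta_ge0 _) (weight_ge0 _)) esum_mkcond.
rewrite -esum_sum; last first.
  by move=> z U _ _; case: ifPn => // _; rewrite mule_ge0 ?weight_ge0.
apply: (@le_trans _ _ (\esum_(z in [set z | fsupp z \subset [set: I]%SET])
    ((8 * eta)%:E * weight [set: I]%SET z))).
  rewrite (_ : [set z | _] = setT); last first.
    by apply/seteqP; split => // z _ /=; exact: finset.subsetT.
  apply: le_esum => z _; rewrite -big_mkcondr/= -ge0_sume_distrl//.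
  rewrite lee_wpmul2r ?weight_ge0// sumEFin lee_fin.
  under eq_bigl => U do rewrite mem_setE.
  by apply: (sum_expr_subsets_le (A := core ^~ z)).
have eta8_ge0 : 0 <= (8 * eta)%:E by rewrite lee_fin mulr_ge0.
by rewrite (esumZl _ eta8_ge0 (weight_ge0 _)) -[leRHS]mule1 lee_wpmul2l.
Qed.

Lemma cheap_fragments_exist (light : set {ffun I -> K}) (m delta eta : R) :
  m%:E <= \esum_(x in light) weight [set: I]%SET x ->
  (0 <= eta)%R -> (eta <= 8^-1)%R ->
  (0 <= delta)%R -> (8 * eta < delta * m)%R ->
  exists2 x, light x & fragment_cost eta x <= delta%:E.
Proof.
move=> light_ge eta_ge0 eta8 delta_ge0 eta_lt.
apply: (exists_le_of_weighted_esum_lt delta_ge0 (weight_ge0 _) _ light_ge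
  (expected_fragment_cost_le eta_ge0 eta8) eta_lt) => x.
exact: fragment_cost_ge0.
Qed.

End fragment_counting.

Section dyadic_grid.
Context {R : realType}.
Variable a : R.
Hypothesis a_gt0 : (0 < a)%R.

Definition level (x : R) : nat := up_log 2 (Num.truncn (x / a)).+1.

Definition grid (k : nat) : R := if k is j.+1 then (a * 2 ^+ j)%R else 0%R.

Lemma level_le x n : (level x <= n)%N = (x < a * 2 ^+ n)%R.
Proof.
rewrite mulrC -ltr_pdivrMr// -natrX /level.
set m := Num.truncn _.
have -> : (up_log 2 m.+1 <= n)%N = (m < 2 ^ n)%N.
  apply/idP/idP => [le_n|]; last exact: up_log_min.
  exact: leq_trans (up_logP _ (ltnSn 1)) (leq_pexp2l (ltn0Sn 1) le_n).
have pred2K : (2 ^ n).-1.+1 = (2 ^ n)%N by rewrite prednK ?expn_gt0.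
by rewrite -pred2K ltnS truncn_le_nat.
Qed.

Lemma level_gt x n : (n < level x)%N = (a * 2 ^+ n <= x)%R.
Proof. by rewrite ltnNge level_le -leNgt. Qed.

Lemma level_eqS x k :
  (level x == k.+1) = (a * 2 ^+ k <= x < a * 2 ^+ k.+1)%R.
Proof. by rewrite eqn_leq level_le level_gt andbC. Qed.

Lemma grid_ge0 k : (0 <= grid k)%R.
Proof. by case: k => //= k; rewrite mulr_ge0 ?exprn_ge0// ltW. Qed.

Lemma ge_grid k : k != 0%N -> (a <= grid k)%R.
Proof.
by case: k => // k _ /=; rewrite ler_peMr ?(ltW a_gt0)// exprn_ege1// ler1n.
Qed.

Lemma grid_level_le x : (0 <= x)%R -> (grid (level x) <= x)%R.
Proof. by case: level (level_gt x) => [|k]//= gt_k _; rewrite -gt_k. Qed.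

Lemma le_grid_level x : (x <= a + 2 * grid (level x))%R.
Proof.
have := level_le x (level x); rewrite leqnn; case: level => [|k]/= /esym/ltW.
  by rewrite expr0 mulr1 mulr0 addr0.
by rewrite exprS mulrCA => /le_trans; apply; rewrite lerDr ltW.
Qed.

Lemma gridK : cancel grid level.
Proof.
case=> [|k] /=; apply/eqP.
  by rewrite -leqn0 level_le expr0 mulr1.
by rewrite level_eqS lexx/= ltr_pM2l// exprS ltr_pMl ?exprn_gt0// ltr1n.
Qed.

Lemma measurable_level_eq k : measurable [set x | level x = k].
Proof.
case: k => [|k].
  rewrite (_ : [set x | _] = `]-oo, (a * 2 ^+ 0)%R[%classic).
    exact: measurable_itv.
  rewrite set_itvNyo; apply/seteqP; split => x /=; rewrite -level_le leqn0.
    by move=> ->.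
  by move/eqP.
rewrite (_ : [set x | _] = `[(a * 2 ^+ k)%R, (a * 2 ^+ k.+1)%R[%classic).
  exact: measurable_itv.
apply/seteqP; split => x /=; rewrite in_itv/= -level_eqS; first by move=> ->.
by move/eqP.
Qed.

End dyadic_grid.

Section countable_preimages.
Context {R : realType} {dd : measure_display} {Omega : measurableType dd}.
Context {J : countType}.
Variables (mu : {measure set Omega -> \bar R}) (Y : Omega -> J).
Hypothesis mY : forall j, measurable (Y @^-1` [set j]).

Lemma measurable_preimage_fibers (D : set J) : measurable (Y @^-1` D).
Proof.
rewrite (_ : _ @^-1` _ = \bigcup_(j in D) Y @^-1` [set j]).
  rewrite bigcup_mkcond; apply: countable_bigcupT_measurable.
    exact: countableP.
  by move=> j; case: ifP.
by apply/seteqP; split => [w DY|w [j Dj /= ->]//]; exists (Y w).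
Qed.

Lemma esum_measure_fibers (D : set J) :
  \esum_(j in D) mu (Y @^-1` [set j]) = mu (Y @^-1` D).
Proof.
have -> : Y @^-1` D = \bigcup_(n in pickle @` D) (pickle \o Y) @^-1` [set n].
  apply/seteqP; split => w /=; first by move=> DY; exists (pickle (Y w)).
  by move=> [_ [j Dj <-]] /(pcan_inj pickleK) ->.
have fiberE j : (pickle \o Y) @^-1` [set pickle j] = Y @^-1` [set j].
  by apply/seteqP; split => w /= => [/(pcan_inj pickleK)|->].
rewrite measure_bigcup; last exact: trivIset_preimage1.
  rewrite nneseries_esum; last by move=> *; exact: measure_ge0.
  rewrite set_mem_set esum_image; last by move=> i j _ _ /(pcan_inj pickleK).
  by apply: eq_esum => j _; rewrite fiberE.
by move=> _ [j _ <-]; rewrite fiberE.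
Qed.

End countable_preimages.

Section lower_integral.
Context {R : realType} {dd : measure_display} {Omega : measurableType dd}.
Variable mu : {measure set Omega -> \bar R}.

(* No measurability is needed: the integral of a nonnegative function is a
   supremum over the simple functions below it. *)
Lemma ge0_le_integral_nomeas (f g : Omega -> \bar R) :
  (forall w, 0 <= f w) -> (forall w, f w <= g w) ->
  \int[mu]_w f w <= \int[mu]_w g w.
Proof.
move=> f0 fg; have g0 w : 0 <= g w by exact: le_trans (f0 w) (fg w).
rewrite !ge0_integralTE//; apply: ereal_sup_le => _ [h /= hf <-].
by exists h => // w; exact: le_trans (hf w) (fg w).
Qed.

Lemma markov_nomeas (g : Omega -> \bar R) (A : set Omega) (c : R) :
  measurable A -> (0 <= c)%R -> (forall w, 0 <= g w) ->
  (forall w, A w -> c%:E <= g w) -> c%:E * mu A <= \int[mu]_w g w.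
Proof.
move=> mA c0 g0 cg; rewrite -(setIT A) -integral_indic//.
rewrite -ge0_integralZl_EFin//; last first.
  by apply/measurable_EFinP; exact: measurable_indic.
apply: ge0_le_integral_nomeas => w; first by rewrite mule_ge0 ?lee_fin.
rewrite indicE; have [/set_mem Aw|_] := boolP (w \in A).
  by rewrite mule1; exact: cg.
by rewrite mule0.
Qed.

End lower_integral.

Lemma markov_setC_nomeas (R : realType) (dd : measure_display)
    (Omega : measurableType dd) (P : probability Omega R)
    (f : Omega -> \bar R) (A : set Omega) (M c : R) :
  (0 < M)%R -> (0 < c)%R -> (forall w, 0 <= f w) -> \int[P]_w f w <= M%:E ->
  measurable A -> (forall w, ~ A w -> (c * M)%:E <= f w) ->
  (1 - c^-1)%:E <= P A.
Proof.
move=> M_gt0 c_gt0 f0 fM mA large.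
have cM_ge0 : (0 <= c * M)%R by rewrite mulr_ge0 ?ltW.
have : (c * M)%:E * P (~` A) <= M%:E.
  by apply: le_trans fM; exact: markov_nomeas (measurableC mA) _ _ _.
rewrite probability_setC// -(fineK (fin_num_measure P A mA)).
rewrite -EFinB -EFinM !lee_fin mulrAC ger_pMl// mulrC -ler_pdivlMr// div1r.
by lra.
Qed.

Section geometric_tail.
Context {R : realFieldType}.
Variables (q : R -> R) (a C : R).
Hypotheses (a_gt0 : (0 < a)%R) (C_gt1 : (1 < C)%R).
Hypothesis q_tail : forall t, (a <= t)%R -> (C * q (2 * t) <= q t)%R.

Lemma tail_iter t j : (a <= t)%R -> (q (2 ^+ j * t) <= C ^- j * q t)%R.
Proof.
move=> a_le; have C_gt0 : (0 < C)%R by rewrite (lt_trans _ C_gt1).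
elim: j => [|j ih]; first by rewrite expr0 invr1 !mul1r.
have ajt : (a <= 2 ^+ j * t)%R.
  apply: (le_trans a_le); rewrite ler_peMl ?exprn_ege1 ?ler1n//.
  exact: le_trans (ltW a_gt0) a_le.
have := le_trans (q_tail ajt) ih; rewrite mulrA -exprS => qj.
by rewrite [in leRHS]exprS invfM -mulrA ler_pdivlMl.
Qed.

Lemma tail_le_increment t :
  (a <= t)%R -> (q t <= C / (C - 1) * (q t - q (2 * t)))%R.
Proof.
by move=> /q_tail qt; rewrite mulrAC ler_pdivlMr ?subr_gt0//; nra.
Qed.

End geometric_tail.

Section random_levels.
Context {R : realType} {dd : measure_display} {Omega : measurableType dd}.
Variables (P : probability Omega R) (a : R).
Hypothesis a_gt0 : (0 < a)%R.

Definition level_prob (Y : {RV P >-> R}) (k : nat) : \bar R :=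
  P (Y @^-1` [set x | level a x = k]).

Lemma measurable_preimage_level (Y : {RV P >-> R}) k :
  measurable (Y @^-1` [set x | level a x = k]).
Proof. by apply: measurable_funPTI; exact: measurable_level_eq. Qed.

Lemma measurable_ge (Y : {RV P >-> R}) (t : R) :
  measurable [set w | (t <= Y w)%R].
Proof.
by rewrite -preimage_itvcy; apply: measurable_funPTI; exact: measurable_itv.
Qed.

Lemma level_probS (Y : {RV P >-> R}) k :
  level_prob Y k.+1 =
  P [set w | (a * 2 ^+ k <= Y w)%R] - P [set w | (a * 2 ^+ k.+1 <= Y w)%R].
Proof.
have fin_ge u : P [set w | (u <= Y w)%R] < +oo.
  by rewrite ltey_eq fin_num_measure//; exact: measurable_ge.
rewrite -[X in _ - P X](@setIidr _ [set w | (a * 2 ^+ k <= Y w)%R]);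
  last first.
  by move=> w /=; apply: le_trans; rewrite ler_pM2l// ler_eXn2l ?ltr1n.
rewrite -measureD ?fin_ge//; try exact: measurable_ge.
congr (P _); apply/seteqP; split => w /=.
  move=> /eqP; rewrite level_eqS// => /andP[-> Y_lt]; split=> //.
  by apply/negP; rewrite -ltNge.
move=> [Y_ge /negP]; rewrite -ltNge => Y_lt; apply/eqP.
by rewrite level_eqS// Y_ge.
Qed.

Lemma tail_le_level_prob (Y : {RV P >-> R}) (C : R) j k : (1 < C)%R ->
  (forall t, (a <= t)%R ->
     C%:E * P [set w | (2 * t <= Y w)%R] <= P [set w | (t <= Y w)%R]) ->
  k != 0%N ->
  P [set w | (2 ^+ j * grid a k <= Y w)%R] <=
    (C ^- j * (C / (C - 1)))%:E * level_prob Y k.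
Proof.
move=> C_gt1 tail; case: k => // k _; rewrite level_probS exprS (mulrCA a)/=.
pose q t := fine (P [set w | (t <= Y w)%R]).
have qE t : P [set w | (t <= Y w)%R] = (q t)%:E.
  by rewrite fineK// fin_num_measure//; exact: measurable_ge.
have q_tail t : (a <= t)%R -> (C * q (2 * t) <= q t)%R.
  by move=> /tail; rewrite !qE -EFinM lee_fin.
have a_le : (a <= a * 2 ^+ k)%R by exact: (ge_grid a_gt0 (k := k.+1)).
rewrite !qE -EFinB -EFinM lee_fin -mulrA.
apply: (le_trans (tail_iter a_gt0 C_gt1 q_tail j a_le)).
rewrite ler_wpM2l ?invr_ge0 ?exprn_ge0 ?(le_trans ler01 (ltW C_gt1))//.
exact: tail_le_increment q_tail _ a_le.
Qed.

Context {d : nat}.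
Variable X : 'I_d -> {RV P >-> R}.
Hypothesis X_indep : mutually_independent X.

Definition level_vector (w : Omega) : {ffun 'I_d -> nat} :=
  [ffun i => level a (X i w)].

Let levels_on (U : {set 'I_d}) (w : Omega) : {ffun 'I_d -> nat} :=
  splice U (level_vector w) 0%R.

Let preimage_levels_on (U : {set 'I_d}) (h : {ffun 'I_d -> nat}) :
  fsupp h \subset U -> levels_on U @^-1` [set h] =
  \bigcap_(i in [set i : 'I_d | i \in U]) X i @^-1` [set x | level a x = h i].
Proof.
move=> hU; apply/seteqP; split => w /= => [<- i /= iU|hw].
  by rewrite !ffunE iU.
apply/ffunP => i; rewrite !ffunE.
by have [/hw|/(fsupp_out hU)] := boolP (i \in U).
Qed.

Let measurable_preimage_levels_on (U : {set 'I_d}) (h : {ffun 'I_d -> nat}) :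
  measurable (levels_on U @^-1` [set h]).
Proof.
have [/preimage_levels_on ->|hU] := boolP (fsupp h \subset U).
  apply: fin_bigcap_measurable; first exact: finite_finset.
  by move=> i _; exact: measurable_preimage_level.
rewrite (_ : _ @^-1` _ = set0)//; apply/seteqP; split => // w /= hw.
by rewrite -hw fsupp_splice0_subset in hU.
Qed.

Let weight_level_prob (U : {set 'I_d}) (h : {ffun 'I_d -> nat}) :
  fsupp h \subset U ->
  weight (fun i => level_prob (X i)) U h = P (levels_on U @^-1` [set h]).
Proof.
move=> /preimage_levels_on ->; rewrite X_indep// => i _.
exact: measurable_level_eq.
Qed.

Lemma weight_level_prob_le1 (U : {set 'I_d}) :
  \esum_(h in [set h : {ffun 'I_d -> nat} | fsupp h \subset U])
    weight (fun i => level_prob (X i)) U h <= 1.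
Proof.
under eq_esum => h hU do rewrite weight_level_prob//.
rewrite esum_measure_fibers//; apply: probability_le1.
exact: measurable_preimage_fibers.
Qed.

Let levels_onT (D : set {ffun 'I_d -> nat}) :
  levels_on [set: 'I_d]%SET @^-1` D = level_vector @^-1` D.
Proof. by apply/seteqP; split => w; rewrite /= /levels_on splice_setT. Qed.

Lemma measurable_preimage_level_vector (D : set {ffun 'I_d -> nat}) :
  measurable (level_vector @^-1` D).
Proof. by rewrite -levels_onT; exact: measurable_preimage_fibers. Qed.

Lemma esum_weight_level_prob (D : set {ffun 'I_d -> nat}) :
  \esum_(x in D) weight (fun i => level_prob (X i)) [set: 'I_d]%SET x =
  P (level_vector @^-1` D).
Proof.
under eq_esum => x _ do rewrite weight_level_prob ?finset.subsetT//.
by rewrite esum_measure_fibers// levels_onT.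
Qed.

Lemma probability_dominates_le (x : 'rV[R]_d) (g : {ffun 'I_d -> nat})
    (eta : R) :
  (forall i, i \in fsupp g ->
     P [set w | (x ord0 i <= X i w)%R] <= eta%:E * level_prob (X i) (g i)) ->
  P [set w | dominates (x, fsupp g) (rv_vector X w)] <=
  (eta ^+ #|fsupp g|)%:E * weight (fun i => level_prob (X i)) (fsupp g) g.
Proof.
move=> tail.
rewrite (_ : [set w | _] =
    \bigcap_(i in [set i : 'I_d | i \in fsupp g]) X i @^-1` `[x ord0 i, +oo[).
  rewrite X_indep; last by move=> i _; exact: measurable_itv.
  rewrite -prodr_const -prodEFin -big_split/=.
  by apply: lee_prod => i ig; rewrite measure_ge0 preimage_itvcy tail.
by apply/seteqP; split => w /= h i /h /=; rewrite mxE in_itv/= andbT.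
Qed.

End random_levels.

Lemma gt0_lty_EFin (R : realDomainType) (x : \bar R) :
  0 < x -> x < +oo -> exists2 r : R, (0 < r)%R & x = r%:E.
Proof. by case: x => // r; rewrite lte_fin => r_gt0 _; exists r. Qed.

Lemma orthant_neq0_gt0 (R : realType) (d : nat) (x : 'rV[R]_d) :
  orthant x -> x != 0%R -> exists i, (0 < x ord0 i)%R.
Proof.
move=> x0 /eqP x_neq0; apply: contrapT => /forallNP x_le0; apply: x_neq0.
apply/rowP => i; apply/eqP; rewrite mxE eq_le x0 andbT leNgt.
exact/negP.
Qed.

Section linear_suprema.
Context {R : realType} {d : nat}.
Variable T : set 'rV[R]_d.
Hypothesis T_ge0 : T `<=` @orthant R d.
Implicit Types (t x : 'rV[R]_d).

Lemma lin_sup_ub t x : T t ->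
  (\sum_(i < d) t ord0 i * x ord0 i)%R%:E <= lin_sup T x.
Proof. by move=> Tt; apply: ereal_sup_ubound; exists t. Qed.

Lemma lin_sup_ge0 x : T !=set0 -> orthant x -> 0 <= lin_sup T x.
Proof.
move=> [t Tt] x0; apply: le_trans (lin_sup_ub x Tt); rewrite lee_fin.
by apply: sumr_ge0 => i _; rewrite mulr_ge0 ?x0// T_ge0.
Qed.

Lemma lin_sup_lty (B : R) x : (forall t, T t -> forall i, (t ord0 i <= B)%R) ->
  orthant x -> lin_sup T x < +oo.
Proof.
move=> TB x0; apply: (@le_lt_trans _ _ (\sum_i B * x ord0 i)%R%:E).
  apply: ge_ereal_sup => _ [t Tt <-]; rewrite lee_fin; apply: ler_sum => i _.
  by rewrite ler_wpM2r ?x0// TB.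
exact: ltry.
Qed.

Context {dd : measure_display} {Omega : measurableType dd}.
Context {P : probability Omega R}.
Variable X : 'I_d -> {RV P >-> R}.
Hypothesis X_ge0 : forall i w, (0 <= X i w)%R.

Lemma rv_vector_ge0 w : orthant (rv_vector X w).
Proof. by move=> i; rewrite mxE. Qed.

Lemma expectation_le_expected_lin_sup t : T t ->
  \sum_(i < d) (t ord0 i)%:E * 'E_P[X i] <= expected_lin_sup T X.
Proof.
move=> Tt; have t0 i : (0 <= t ord0 i)%R by exact: T_ge0.
have mX i : measurable_fun setT (fun w => (X i w)%:E).
  by apply/measurable_EFinP; exact: measurable_funPT.
have -> : \sum_(i < d) (t ord0 i)%:E * 'E_P[X i] =
    \int[P]_w (\sum_(i < d) (t ord0 i)%:E * (X i w)%:E).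
  rewrite ge0_integral_sum//.
  - apply: eq_bigr => i _; rewrite unlock ge0_integralZl_EFin//.
    by move=> w _; rewrite lee_fin.
  - by move=> i; apply: emeasurable_funM => //; exact: measurable_cst.
  - by move=> i w _; rewrite mule_ge0 ?lee_fin.
apply: ge0_le_integral_nomeas => w.
  by apply: sume_ge0 => i _; rewrite mule_ge0 ?lee_fin.
apply: le_trans (lin_sup_ub _ Tt); rewrite -sumEFin; apply: lee_sum => i _.
by rewrite mxE EFinM.
Qed.

Lemma expectation_term_le_expected_lin_sup t i : T t ->
  (t ord0 i)%:E * 'E_P[X i] <= expected_lin_sup T X.
Proof.
move=> Tt; apply: le_trans (expectation_le_expected_lin_sup Tt).
rewrite (bigD1 i)//= leeDl// sume_ge0// => k _.
by rewrite mule_ge0 ?expectation_ge0// lee_fin T_ge0.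
Qed.

Lemma expectation_lty t i : T t -> (0 < t ord0 i)%R ->
  expected_lin_sup T X < +oo -> 'E_P[X i] < +oo.
Proof.
move=> Tt ti; move/(le_lt_trans (expectation_term_le_expected_lin_sup i Tt)).
by rewrite !ltey; apply: contra_neq => ->; rewrite gt0_muley.
Qed.

Lemma expected_lin_sup_gt0 t i : T t -> (0 < t ord0 i)%R ->
  0 < 'E_P[X i] -> 0 < expected_lin_sup T X.
Proof.
move=> Tt ti Xi; apply: lt_le_trans (expectation_term_le_expected_lin_sup i Tt).
by rewrite mule_gt0.
Qed.

End linear_suprema.

Lemma identically_distributed_expectation (R : realType) (dd : measure_display)
    (Omega : measurableType dd) (P : probability Omega R) (d : nat)
    (X : 'I_d -> {RV P >-> R}) (i j : 'I_d) :
  (forall i w, (0 <= X i w)%R) -> identically_distributed X ->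
  'E_P[X i] = 'E_P[X j].
Proof.
move=> X_ge0 idX.
have distE k : 'E_P[X k] = \int[distribution P (X k)]_y (`|y|)%:E.
  rewrite unlock ge0_integral_distribution//.
  - by apply: eq_integral => w _ /=; rewrite ger0_norm.
  - by apply/measurable_EFinP; exact: normr_measurable.
rewrite !distE; apply: eq_measure_integral => A mA _; exact: idX.
Qed.

(* At [t = 0] the tail condition would read [C <= 1]. *)
Lemma expectation_gt0 (R : realType) (dd : measure_display)
    (Omega : measurableType dd) (P : probability Omega R) (Y : {RV P >-> R})
    (C K : R) :
  (forall w, (0 <= Y w)%R) -> (1 < C)%R ->
  (forall t : R, K%:E * 'E_P[Y] <= t%:E ->
    C%:E * P [set w | (2 * t <= Y w)%R] <= P [set w | (t <= Y w)%R]) ->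
  0 < 'E_P[Y].
Proof.
move=> Y_ge0 C_gt1 tail; rewrite lt_neqAle expectation_ge0// andbT.
apply/eqP => EY0; have := tail 0%R; rewrite -EY0 mule0 lexx mulr0 => /(_ isT).
rewrite (_ : [set w | _] = setT); last by apply/seteqP; split => w _ //=.
by rewrite probability_setT mule1 lee_fin leNgt C_gt1.
Qed.

Lemma expr_inv_lt (R : realType) (C b eps : R) :
  (1 < C)%R -> (0 < eps)%R -> exists j, (C ^- j * b < eps)%R.
Proof.
move=> C_gt1 eps_gt0; have C_gt0 : (0 < C)%R by rewrite (lt_trans _ C_gt1).
have : (geometric b C^-1 n @[n --> \oo] --> (0 : R))%R.
  by apply: cvg_geometric; rewrite ger0_norm ?invr_ge0 ?ltW// invf_lt1.
move=> /cvgr_lt/(_ _ eps_gt0)[j _ /(_ j (leqnn j))] /= small.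
by exists j; rewrite mulrC -exprVn.
Qed.

Section fragment_covers.
Context {R : realType} {dd : measure_display} {Omega : measurableType dd}.
Context {P : probability Omega R} {d : nat}.
Variables (C K mu M : R) (j : nat).
Variables (T : set 'rV[R]_d) (X : 'I_d -> {RV P >-> R}).
Hypotheses (K_ge1 : (1 <= K)%R) (mu_gt0 : (0 < mu)%R) (M_gt0 : (0 < M)%R).
Hypothesis T_ge0 : T `<=` @orthant R d.
Hypothesis X_ge0 : forall i w, (0 <= X i w)%R.
Hypothesis X_mean : forall i, 'E_P[X i] = mu%:E.
Hypothesis T_mean : expected_lin_sup T X = M%:E.

Local Notation a := (K * mu)%R.
Let a_gt0 : (0 < a)%R. Proof. by rewrite mulr_gt0// (lt_le_trans _ K_ge1). Qed.

Definition grid_load (t : 'rV[R]_d) (i : 'I_d) (k : nat) : R :=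
  (t ord0 i * grid a k)%R.

Lemma grid_load_ge0 t : T t -> forall i k, (0 <= grid_load t i k)%R.
Proof. by move=> Tt i k; rewrite mulr_ge0 ?T_ge0// grid_ge0. Qed.

Definition light_levels : set {ffun 'I_d -> nat} :=
  [set x | forall t, T t -> ((\sum_i loads grid_load t x i) *+ 2 < 4 * M)%R].

Definition level_fragments (x : {ffun 'I_d -> nat}) : set {ffun 'I_d -> nat} :=
  fragments (heavy_core T grid_load (4 * M)%R) x.

Definition threshold (g : {ffun 'I_d -> nat}) : 'rV[R]_d * {set 'I_d} :=
  (\row_i (2 ^+ j * grid a (g i))%R, fsupp g).

Let exp2j_gt0 : (0 < 2 ^+ j :> R)%R. Proof. by rewrite exprn_gt0. Qed.

Lemma sum_mean_le t : T t -> (a * \sum_i t ord0 i <= K * M)%R.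
Proof.
move=> Tt; rewrite -mulrA ler_wpM2l ?(le_trans ler01)//.
have := expectation_le_expected_lin_sup T_ge0 X_ge0 Tt.
under eq_bigr do rewrite X_mean -EFinM.
by rewrite T_mean sumEFin lee_fin -mulr_suml mulrC.
Qed.

Lemma large_vector_level (x : 'rV[R]_d) :
  orthant x -> (2 ^+ j * (K + 9) * M)%:E <= lin_sup T x ->
  exists y : {ffun 'I_d -> nat},
    (forall i, (2 ^+ j * grid a (y i) <= x ord0 i)%R) /\
    (exists2 t, T t & (4 * M <= \sum_i loads grid_load t y i)%R).
Proof.
move=> x0 xL; exists [ffun i => level a (x ord0 i / 2 ^+ j)%R]; split => [i|].
  rewrite ffunE mulrC -ler_pdivlMr// grid_level_le//.
  by rewrite divr_ge0 ?x0// ltW.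
have : (2 ^+ j * ((K + 8) * M))%:E < lin_sup T x.
  apply: lt_le_trans xL; rewrite lte_fin -mulrA ltr_pM2l// ltr_pM2r//.
  by rewrite ltrD2l ltr_nat.
move=> /ereal_sup_gt[_ [t Tt <-]]; rewrite lte_fin => tx; exists t => //.
set s := (\sum_i _)%R; have mean_le := sum_mean_le Tt.
have : (\sum_i t ord0 i * x ord0 i <= 2 ^+ j * (a * \sum_i t ord0 i + 2 * s))%R.
  rewrite !mulr_sumr -big_split/= mulr_sumr; apply: ler_sum => i _.
  rewrite /loads /grid_load ffunE; set k := level _ _.
  have : (x ord0 i / 2 ^+ j <= a + 2 * grid a k)%R by exact: le_grid_level.
  rewrite ler_pdivrMr// => /(ler_wpM2l (T_ge0 Tt i)); nra.
by move=> /(lt_le_trans tx); rewrite ltr_pM2l//; lra.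
Qed.

Lemma half_le_light_levels : T !=set0 ->
  (2^-1)%:E <= P (level_vector a X @^-1` light_levels).
Proof.
move=> T_neq0; rewrite (_ : 2^-1 = 1 - 2^-1)%R; last by lra.
have T_mean_le : \int[P]_w lin_sup T (rv_vector X w) <= M%:E.
  by rewrite -T_mean.
apply: markov_setC_nomeas M_gt0 (ltr0n R 2) _ T_mean_le _ _.
- by move=> w; apply: lin_sup_ge0 => //; exact: rv_vector_ge0.
- exact: measurable_preimage_level_vector.
move=> w /existsNP[t /not_implyP[Tt /negP]]; rewrite -leNgt => heavy_w.
apply: le_trans (lin_sup_ub _ Tt); rewrite lee_fin.
apply: (@le_trans _ _ (\sum_i loads grid_load t (level_vector a X w) i)%R).
  by move: heavy_w M_gt0; lra.
apply: ler_sum => i _; rewrite /loads /grid_load ffunE mxE ler_wpM2l ?T_ge0//.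
exact: grid_level_le.
Qed.

Lemma threshold_ge g i : i \in fsupp g -> (a <= (threshold g).1 ord0 i)%R.
Proof.
rewrite inE mxE => gi; apply: le_trans (ge_grid a_gt0 gi) _.
by rewrite ler_peMl ?grid_ge0// exprn_ege1// ler1n.
Qed.

Lemma threshold_inj : injective threshold.
Proof.
move=> g h [/rowP gh _]; apply/ffunP => i; have := gh i; rewrite !mxE.
by move=> /(mulfI (lt0r_neq0 exp2j_gt0))/(can_inj (gridK a_gt0)).
Qed.

Lemma fragments_dominate x (z : 'rV[R]_d) : light_levels x -> orthant z ->
  (2 ^+ j * (K + 9) * M)%:E <= lin_sup T z ->
  exists2 g, level_fragments x g & dominates (threshold g) z.
Proof.
move=> light z0 /(large_vector_level z0)[y [yz y_heavy]].
have load0 t : T t -> forall i, grid_load t i 0 = 0%R.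
  by move=> _ i; exact: mulr0.
have [g xg gy] := fragment_exists grid_load_ge0 load0 light y_heavy.
by exists g => // i ig; rewrite mxE gy.
Qed.

Hypotheses (C_gt1 : (1 < C)%R) (X_indep : mutually_independent X).
Hypothesis X_tail : forall (i : 'I_d) (t : R), (K * mu <= t)%R ->
  C%:E * P [set w | (2 * t <= X i w)%R] <= P [set w | (t <= X i w)%R].

Local Notation eta := (C ^- j * (C / (C - 1)))%R.

Lemma probability_threshold_le g :
  P [set w | dominates (threshold g) (rv_vector X w)] <=
  (eta ^+ #|fsupp g|)%:E * weight (fun i => level_prob a (X i)) (fsupp g) g.
Proof.
apply: probability_dominates_le => // i; rewrite inE mxE => gi.
by apply: tail_le_level_prob => // t; exact: X_tail.
Qed.

Lemma cheap_level_fragments_exist (delta : R) :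
  T !=set0 -> (0 < delta)%R -> (delta < 1)%R -> (eta < delta / 16)%R ->
  exists2 x, light_levels x &
    \esum_(g in level_fragments x)
      P [set w | dominates (threshold g) (rv_vector X w)] <= delta%:E.
Proof.
move=> T_neq0 delta_gt0 delta_lt1 eta_small.
have eta_ge0 : (0 <= eta)%R.
  by rewrite mulr_ge0 ?invr_ge0 ?exprn_ge0 ?divr_ge0//; move: C_gt1; lra.
have light := half_le_light_levels T_neq0.
rewrite -esum_weight_level_prob// in light.
have prob_ge0 i k : 0 <= level_prob a (X i) k by exact: measure_ge0.
have [||x light_x cheap] := cheap_fragments_exist prob_ge0
  (card_heavy_core T grid_load (4 * M)%R) (weight_level_prob_le1 a_gt0 X_indep)
  light eta_ge0 _ (ltW delta_gt0); [lra|lra|].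
exists x => //; apply: le_trans cheap; apply: le_esum => g _.
exact: probability_threshold_le.
Qed.

Lemma fragment_cover (delta : R) :
  T !=set0 -> (0 < delta)%R -> (delta < 1)%R -> (eta < delta / 16)%R ->
  exists G : set ('rV[R]_d * {set 'I_d}),
  [/\ G `<=` [set g | orthant g.1],
      forall g, G g -> forall i, i \in g.2 ->
        K%:E * 'E_P[X i] <= (g.1 ord0 i)%:E,
      [set x | orthant x /\
          (2 ^+ j * (K + 9))%:E * expected_lin_sup T X <= lin_sup T x]
        `<=` \bigcup_(g in G) [set x | orthant x /\ dominates g x]
    & \esum_(g in G) P [set w | dominates g (rv_vector X w)] <= delta%:E].
Proof.
move=> T_neq0 delta_gt0 delta_lt1 eta_small.
have [x light cheap] := cheap_level_fragments_exist T_neq0 delta_gt0 delta_lt1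
  eta_small.
exists (threshold @` level_fragments x); split.
- by move=> _ [g _ <-] i /=; rewrite mxE mulr_ge0 ?grid_ge0// ltW.
- by move=> _ [g _ <-] i /=; rewrite X_mean -EFinM lee_fin; exact: threshold_ge.
- move=> z [z0]; rewrite T_mean -EFinM.
  move=> /(fragments_dominate light z0)[g xg gz].
  by exists (threshold g) => //; exists g.
- by rewrite esum_image// => g h _ _; exact: threshold_inj.
Qed.

End fragment_covers.

Theorem theorem2p3 (R : realType) (delta C K : R)
    (delta_gt0 : (0 < delta)%R) (delta_lt1 : (delta < 1)%R)
    (C_gt1 : (1 < C)%R) (K_ge1 : (1 <= K)%R) :
  exists L : R,
  forall (d : nat) (T : set 'rV[R]_d)
    (T_nonneg : T `<=` @orthant R d)
    (T_nontrivial : exists2 t, T t & t != 0%R)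
    (T_bounded : exists M : R, forall t, T t -> forall i, (t ord0 i <= M)%R)
    (dd : measure_display) (Omega : measurableType dd)
    (P : probability Omega R) (X : 'I_d -> {RV P >-> R})
    (X_nonneg : forall i w, (0 <= X i w)%R)
    (X_iid : iid X)
    (X_tail : forall (i : 'I_d) (t : R), K%:E * 'E_P[X i] <= t%:E ->
      C%:E * P [set w | (2 * t <= X i w)%R] <= P [set w | (t <= X i w)%R]),
  exists G : set ('rV[R]_d * {set 'I_d}),
    [/\ G `<=` [set g | orthant g.1],
        forall g, G g -> forall i, i \in g.2 ->
          K%:E * 'E_P[X i] <= (g.1 ord0 i)%:E,
        [set x | orthant x /\ L%:E * expected_lin_sup T X <= lin_sup T x]
          `<=` \bigcup_(g in G) [set x | orthant x /\ dominates g x]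
      & \esum_(g in G) P [set w | dominates g (rv_vector X w)] <= delta%:E].
Proof.
have delta16_gt0 : (0 < delta / 16)%R by rewrite divr_gt0.
have [j j_large] := expr_inv_lt (C / (C - 1)) C_gt1 delta16_gt0.
exists (2 ^+ j * (K + 9))%R => d T T_ge0 [t Tt t_neq0] [B TB].
move=> dd Omega P X X_ge0 [X_indep X_id] X_tail.
have [i ti] := orthant_neq0_gt0 (T_ge0 t Tt) t_neq0.
have [T_infty|T_fin] := eqVneq (expected_lin_sup T X) +oo.
  exists set0; split => //; last by rewrite esum_set0 lee_fin ltW.
  move=> x [x0]; rewrite T_infty gt0_muley; last first.
    by rewrite lte_fin mulr_gt0 ?exprn_gt0//; lra.
  by rewrite leNgt (lin_sup_lty TB).
have Xi_gt0 := expectation_gt0 (X_ge0 i) C_gt1 (X_tail i).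
have T_gt0 := expected_lin_sup_gt0 T_ge0 X_ge0 Tt ti Xi_gt0.
have T_lty : expected_lin_sup T X < +oo by rewrite ltey.
have Xi_lty := expectation_lty T_ge0 X_ge0 Tt ti T_lty.
have [M M_gt0 T_mean] := gt0_lty_EFin T_gt0 T_lty.
have [mu mu_gt0 Xi_mean] := gt0_lty_EFin Xi_gt0 Xi_lty.
have X_mean k : 'E_P[X k] = mu%:E.
  by rewrite -Xi_mean; exact: identically_distributed_expectation.
apply: (fragment_cover K_ge1 mu_gt0 M_gt0 T_ge0 X_ge0 X_mean T_mean C_gt1
  X_indep _ _ delta_gt0 delta_lt1 j_large); last by exists t.
by move=> k s; rewrite -lee_fin EFinM -(X_mean k); exact: X_tail.
Qed.
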